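(* For $(x,y)\in D=[-1,1]^2$, assume the representation $$f(x,y)\sim\sum_{j=0}^{\infty}{}'g_j(x)T_j(y),\qquad\text{where}\quad g_j(x)=\sum_{i=0}^{\infty}{}'c_{i,j}T_i(x),$$ where $c_{i,j}$ are the Chebyshev coefficients of $f$. Let $\tilde c_{i,j}$ be the approximated coefficients given by the Gauss-Chebyshev quadrature rule $$\tilde c_{i,j}=\frac{4}{n_xn_y}\sum_{l_x=1}^{n_x}\sum_{l_y=1}^{n_y}f(x_{l_x},y_{l_y})T_i(x_{l_x})T_j(y_{l_y}),$$ where $x_{l_x}$ ($l_x=1,\dots,n_x$) and $y_{l_y}$ ($l_y=1,\dots,n_y$) are the roots of the Chebyshev polynomials $T_{n_x}(x)$ and $T_{n_y}(y)$, respectively. Then $$\tilde c_{i,j}=c_{i,j}+\sum_{k_x=1}^{\infty}(-1)^{k_x}\left(c_{2k_xn_x-i,j}+c_{2k_xn_x+i,j}\right)+\sum_{k_y=1}^{\infty}(-1)^{k_y}\left(c_{i,2k_yn_y-j}+c_{i,2k_yn_y+j}\right)$$ $$+\sum_{k_x=1}^{\infty}\sum_{k_y=1}^{\infty}(-1)^{k_x+k_y}\left(c_{2k_xn_x-i,2k_yn_y-j}+c_{2k_xn_x-i,2k_yn_y+j}+c_{2k_xn_x+i,2k_yn_y-j}+c_{2k_xn_x+i,2k_yn_y+j}\right).$$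
   Context: $T_i(x)=\cos(i\cos^{-1}x)$ is the Chebyshev polynomial of degree $i$. The (exact) Chebyshev coefficients of a function $f$ on $D=[-1,1]^2$ are $$c_{i,j}=\frac{4}{\pi^2}\int_0^\pi\!\!\int_0^\pi f(\cos\theta_x,\cos\theta_y)\cos(i\theta_x)\cos(j\theta_y)\,d\theta_x\,d\theta_y .$$ A prime on a summation sign means that the first (index-zero) term is halved. The symbol $\sim$ denotes the assumed (formal) representation of $f$ by its Chebyshev series. $n_x,n_y$ are the numbers of quadrature points in the $x$ and $y$ directions.
   Formalization: The representation ∼ is taken as pointwise iterated convergence on D; the displayed formula is proved when the k_y-sum and the double sum converge (the double sum jointly and along rows and columns); without this only the form with the k_y-sums merged is proved. *)

(* Defs.v *)
From HB Require Import structures.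
From mathcomp Require Import all_boot all_order all_algebra.
From mathcomp Require Import all_classical all_reals all_analysis.

Set Implicit Arguments.
Unset Strict Implicit.
Unset Printing Implicit Defensive.

Import Order.TTheory GRing.Theory Num.Theory.
Import numFieldNormedType.Exports.

Local Open Scope classical_set_scope.
Local Open Scope ring_scope.

(* Only meaningful for x in [-1, 1], the domain of arccos. *)
Definition chebT (R : realType) (i : nat) (x : R) : R := cos (i%:R * acos x).

(* The indices are integers: c_{2kn-i, j} may have a negative first index when
   i > 2kn, and the integral formula is then still the intended one (it is even
   in each index).  The integrals are Lebesgue integrals. *)
Definition chebCoef (R : realType) (f : R -> R -> R) (i j : int) : R :=
  4 / pi ^+ 2 *
  \int[lebesgue_measure]_(ty in `[0, pi])
    \int[lebesgue_measure]_(tx in `[0, pi])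
      (f (cos tx) (cos ty) * cos (i%:~R * tx) * cos (j%:~R * ty)).

(* Partial sums of a primed series: the term of index 0 is halved. *)
Definition primed_series (R : realType) (u : nat -> R) : nat -> R :=
  series (fun k => if k == 0%N then u 0%N / 2 else u k).

Definition chebRoots (R : realType) (n : nat) (x : 'I_n -> R) : Prop :=
  injective x /\
  range x = [set t : R | -1 <= t <= 1 /\ chebT n t = 0].

Definition quadCoef (R : realType) (f : R -> R -> R) (nx ny : nat)
    (x : 'I_nx -> R) (y : 'I_ny -> R) (i j : nat) : R :=
  4 / (nx%:R * ny%:R) *
  \sum_(lx < nx) \sum_(ly < ny)
     f (x lx) (y ly) * chebT i (x lx) * chebT j (y ly).

Notation "\sum_ ( m <= i <oo ) F" :=
  (\big[+%R/0%R]_(m <= i <oo) F%R) : ring_scope.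

(* Series indexed by k >= 1, with sum \sum_(1 <= k <oo) u k. *)
Definition cvg_series1 (R : realType) (u : nat -> R) : Prop :=
  cvgn (fun K => \sum_(1 <= k < K) u k).

(* Regular convergence in the sense of Hardy: the rectangular partial sums
   converge jointly (Pringsheim), and so do all rows and all columns. *)
Definition cvg_double_series1 (R : realType) (u : nat -> nat -> R) : Prop :=
  [/\ cvg ((fun K : nat * nat =>
             \sum_(1 <= k < K.1) \sum_(1 <= l < K.2) u k l) @ (\oo, \oo)),
      forall k, (0 < k)%N -> cvg_series1 (u k) &
      forall l, (0 < l)%N -> cvg_series1 (u^~ l)].

(* Main.v *)
Require Import Defs.
From HB Require Import structures.
From mathcomp Require Import all_boot all_order all_algebra.
From mathcomp Require Import all_classical all_reals all_analysis.
From mathcomp Require Import ring lra zify.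
Set Implicit Arguments.
Unset Strict Implicit.
Unset Printing Implicit Defensive.
Import Order.TTheory GRing.Theory Num.Theory.
Import numFieldNormedType.Exports.
Local Open Scope classical_set_scope.
Local Open Scope ring_scope.

(** The nodes are the cosines of the angles (2l+1)pi/(2n), and the mean of
    cos (p t) over these angles is (-1)^r if p = 2rn and 0 if 2n does not divide
    p.  Hence in one variable the quadrature rule, applied term by term to
    F = sum' a_k T_k, keeps exactly the a_k with k = 2rn + i or k = 2rn - i,
    with sign (-1)^r.  This is used in x for each g_m, and then in y for the
    series whose coefficients are the x-quadratures of the g_m. *)

(** * Cosine means over the Chebyshev angles *)

Section Trig.
Variable R : realType.
Implicit Types (n : nat) (p : int).

Definition gaussAngle n (l : nat) : R := (2 * l + 1)%:R * pi / (2 * n)%:R.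

Lemma gaussAngle_itv n (l : 'I_n) : gaussAngle n l \in `[0, pi].
Proof.
have n0 : 0 < (2 * n)%:R :> R by rewrite ltr0n; have := ltn_ord l; lia.
rewrite in_itv /= /gaussAngle divr_ge0 ?mulr_ge0 ?pi_ge0 //=.
rewrite ler_pdivrMr // mulrC ler_wpM2l ?pi_ge0 // ler_nat.
by have := ltn_ord l; lia.
Qed.

Lemma gaussAngle_inj n : injective (fun l : 'I_n => cos (gaussAngle n l)).
Proof.
move=> l l' /(cos_inj (gaussAngle_itv l) (gaussAngle_itv l')).
have n0 : (2 * n)%:R != 0 :> R by rewrite pnatr_eq0; have := ltn_ord l; lia.
move=> /(divIf n0) /(mulIf (lt0r_neq0 (pi_gt0 R))) /eqP.
by rewrite eqr_nat => /eqP E; apply/val_inj => /=; lia.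
Qed.

Lemma chebT_cos (m : nat) (t : R) : t \in `[0, pi] ->
  chebT m (cos t) = cos (m%:R * t).
Proof. by move=> ht; rewrite /chebT cosK. Qed.

Lemma chebT_gaussAngle n (l : 'I_n) : chebT n (cos (gaussAngle n l)) = 0.
Proof.
rewrite chebT_cos ?gaussAngle_itv // /gaussAngle.
have n0 : n%:R != 0 :> R by rewrite pnatr_eq0; have := ltn_ord l; lia.
have -> : n%:R * ((2 * l + 1)%:R * pi / (2 * n)%:R) = pi / 2 + pi *+ l :> R.
  by rewrite -mulr_natr !natrM natrD natrM; field.
by rewrite (alternatingn (@cosDpi R)) cos_pihalf mulr0.
Qed.

(** Each [cos (gaussAngle n l)] is a root, hence some [x (s l)]; injectivity makes [s] a permutation
    of the indices. *)
Lemma sum_chebRoots n (x : 'I_n -> R) (h : R -> R) : chebRoots x ->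
  \sum_(l < n) h (x l) = \sum_(l < n) h (cos (gaussAngle n l)).
Proof.
move=> [x_inj x_range].
have ex (l : 'I_n) : exists l', x l' = cos (gaussAngle n l).
  have : range x (cos (gaussAngle n l)).
    by rewrite x_range /= cos_geN1 cos_le1 chebT_gaussAngle.
  by case=> l' _ <-; exists l'.
pose s l := projT1 (cid (ex l)).
have xs l : x (s l) = cos (gaussAngle n l) by exact: projT2 (cid (ex l)).
have s_inj : injective s.
  by move=> l l' /(congr1 x); rewrite !xs; exact: gaussAngle_inj.
rewrite (reindex s); last exact/onW_bij/injF_bij.
by apply: eq_bigr => l _; rewrite xs.
Qed.

Definition cosMean n p : R :=
  n%:R^-1 * \sum_(l < n) cos (p%:~R * gaussAngle n l).

Lemma cosMeanN n p : cosMean n (- p) = cosMean n p.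
Proof.
by rewrite /cosMean; congr (_ * _); apply: eq_bigr => l _; rewrite mulrNz mulNr cosN.
Qed.

Lemma cosMean_norm n p : (0 < n)%N -> `|cosMean n p| <= 1.
Proof.
move=> n0; rewrite normrM ger0_norm ?invr_ge0 // mulrC ler_pdivrMr ?ltr0n // mul1r.
apply: (le_trans (ler_norm_sum _ _ _)).
apply: (@le_trans _ _ (\sum_(l < n) 1)); first by apply: ler_sum => l _; exact: cos_max.
by rewrite sumr_const card_ord.
Qed.

(** Product-to-sum formula; its two frequencies are the source of the two families k = 2rn + i and k
    = 2rn - i. *)
Lemma cosMean_mul n (k i : int) :
  2 / n%:R * \sum_(l < n) cos (k%:~R * gaussAngle n l) * cos (i%:~R * gaussAngle n l)
  = cosMean n (k - i) + cosMean n (k + i).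
Proof.
rewrite /cosMean -mulrDr -big_split /= [2 / _]mulrC -mulrA; congr (_ * _).
rewrite mulr_sumr; apply: eq_bigr => l _.
set t := gaussAngle n l.
have -> : (k - i)%:~R * t = k%:~R * t - i%:~R * t :> R by rewrite intrB mulrBl.
have -> : (k + i)%:~R * t = k%:~R * t + i%:~R * t :> R by rewrite intrD mulrDl.
by rewrite cosB cosD; ring.
Qed.

(** At every angle the argument is an odd multiple of r pi, so all n cosines equal (-1)^r. *)
Lemma cosMean_dvd n r : (0 < n)%N -> cosMean n (2 * r * n)%N%:Z = (-1) ^+ r.
Proof.
move=> n0; have n0' : n%:R != 0 :> R by rewrite pnatr_eq0 -lt0n.
rewrite /cosMean (eq_bigr (fun _ : 'I_n => (-1) ^+ r : R)).
  by rewrite sumr_const card_ord mulrnAr -mulrnAl -[n%:R^-1 *+ n]mulr_natr mulVf // mul1r.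
move=> l _; rewrite /gaussAngle -pmulrn.
have -> : (2 * r * n)%:R * ((2 * l + 1)%:R * pi / (2 * n)%:R)
    = 0 + pi *+ (r * (2 * l + 1)) :> R.
  by rewrite add0r -mulr_natr !(natrM, natrD); field.
rewrite (alternatingn (@cosDpi R)) cos0 mulr1 exprM exprD expr1.
by rewrite exprM sqrr_sign expr1n mul1r.
Qed.

(** Telescoping: 2 sin a cos((2l+1)a) = sin((2l+2)a) - sin(2la). *)
Lemma sin_mul_sum_cos (a : R) n :
  2 * sin a * \sum_(l < n) cos ((2 * l + 1)%:R * a) = sin ((2 * n)%:R * a).
Proof.
elim: n => [|n IH]; first by rewrite big_ord0 mulr0 muln0 mul0r sin0.
rewrite big_ord_recr /= mulrDr {}IH.
have -> : (2 * n)%:R * a = (2 * n + 1)%:R * a - a by rewrite natrD; ring.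
have -> : (2 * n.+1)%:R * a = (2 * n + 1)%:R * a + a.
  by rewrite mulnS addnC !natrD; ring.
by rewrite sinB sinD; ring.
Qed.

(** For a = p pi/(2n), the sum times 2 sin a is sin(p pi) = 0, and sin a is nonzero because 2n does
    not divide p. *)
Lemma cosMean_ndvd n (p : nat) : ~~ (2 * n %| p)%N -> cosMean n p%:Z = 0.
Proof.
have [->|n0] := posnP n; first by rewrite /cosMean big_ord0 mulr0.
have n0' : n%:R != 0 :> R by rewrite pnatr_eq0 -lt0n.
move=> ndvd; rewrite /cosMean; apply/eqP; rewrite mulf_eq0; apply/orP; right.
pose a : R := p%:R * pi / (2 * n)%:R.
rewrite (eq_bigr (fun l : 'I_n => cos ((2 * l + 1)%:R * a))); last first.
  by move=> l _; congr cos; rewrite /gaussAngle /a -pmulrn; ring.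
have sa : sin a != 0.
  (* Reducing p modulo 2n changes sin a at most by a sign and puts the angle strictly between 0 and
     pi. *)
  have -> : a = (p %% (2 * n))%:R * pi / (2 * n)%:R + pi *+ (p %/ (2 * n)).
    rewrite /a {1}(divn_eq p (2 * n)) -[in RHS]mulr_natr !(natrM, natrD); field.
    by [].
  rewrite (alternatingn (@sinDpi R)); apply: mulf_neq0; first by rewrite signr_eq0.
  have r0 : (0 < p %% (2 * n))%N by rewrite lt0n.
  have rn : (p %% (2 * n) < 2 * n)%N by rewrite ltn_mod muln_gt0.
  have nn : 0 < (2 * n)%:R :> R by rewrite ltr0n muln_gt0.
  apply/lt0r_neq0/sin_gt0_pi; rewrite divr_gt0 ?mulr_gt0 ?pi_gt0 ?ltr0n ?muln_gt0 //=.
  by rewrite ltr_pdivrMr // mulrC ltr_pM2l ?pi_gt0 // ltr_nat.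
have /eqP := sin_mul_sum_cos a n.
have -> : (2 * n)%:R * a = 0 + pi *+ p.
  by rewrite /a add0r -mulr_natr !natrM; field.
rewrite (alternatingn (@sinDpi R)) sin0 mulr0 !mulf_eq0 (negPf sa).
by rewrite pnatr_eq0.
Qed.

End Trig.

(** * Primed series and aliasing in one variable *)

Section Series.
Variable R : realType.
Implicit Types (u v : nat -> R) (h : int -> R).

(** Among the 2n indices added when N grows by one, only the first is a multiple of 2n. *)
Lemma sum_cosMean (F : nat -> R) n N : (0 < n)%N ->
  \sum_(0 <= k < 2 * N * n) F k * cosMean R n k%:Z
  = \sum_(0 <= r < N) (-1) ^+ r * F (2 * r * n)%N.
Proof.
move=> n0; elim: N => [|N IH]; first by rewrite muln0 mul0n !big_geq.
rewrite big_nat_recr //= -IH.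
have le1 : (2 * N * n < 2 * N.+1 * n)%N by nia.
rewrite (big_cat_nat (n := (2 * N * n)%N)) //=; last exact: ltnW.
congr (_ + _); rewrite big_ltn // cosMean_dvd // mulrC.
rewrite big_nat_cond big1 ?addr0 // => k /andP[/andP[k1 k2] _].
rewrite cosMean_ndvd ?mulr0 //; apply/negP => /dvdnP[q qE].
have : (N < q < N.+1)%N by nia.
lia.
Qed.

Lemma primed_seriesS u K : primed_series u K.+1 =
  u 0%N / 2 + \sum_(1 <= k < K.+1) u k.
Proof.
rewrite /primed_series /series /= big_ltn //=; congr (_ + _).
by apply: eq_big_nat => k /andP[k0 _]; rewrite gtn_eqF.
Qed.

Lemma primed_series_decay u (l : R) : primed_series u @ \oo --> l -> u @ \oo --> 0.
Proof.
move=> ul; have /cvg_series_cvg_0 : cvgn (primed_series u) by apply/cvg_ex; exists l.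
(* After a shift by one, the halved term of index 0 is gone and the two sequences coincide. *)
rewrite -[X in X -> _]cvg_shiftS -[X in _ -> X]cvg_shiftS /=.
exact.
Qed.

(* The two windows of summation, centred at 0 and at p, differ by p terms at
   each end, and these tend to 0. *)
Lemma primed_series_shift h u (l : R) (p : nat) :
  (forall k, `|h k| <= u `|k|%N) -> u @ \oo --> 0 ->
  primed_series (fun k => h k%:Z + h (- k%:Z)) @ \oo --> l ->
  primed_series (fun k => h (p%:Z + k%:Z) + h (p%:Z - k%:Z)) @ \oo --> l.
Proof.
move=> hu u0 hl.
have h0 (phi : nat -> int) : (fun K => `|phi K|%N) @ \oo --> \oo ->
    (fun K => h (phi K)) @ \oo --> 0.
  move=> phioo; apply: norm_cvg0.
  apply: (@squeeze_cvgr _ _ _ _ (cst 0) (fun K => u `|phi K|%N)).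
  - by near=> K; rewrite normr_ge0 hu.
  - exact: cvg_cst.
  - exact: (cvg_comp _ _ phioo u0).
elim: p => [|p IH].
  by under [X in primed_series X]eq_fun do rewrite add0r sub0r.
(* At length [K.+1] the primed sum is the plain sum of [h] over the integers within K of the centre,
   since halving counts the centre once. *)
rewrite -cvg_shiftS in IH; rewrite -cvg_shiftS.
apply: cvg_sub0 IH.
have -> : (fun K => primed_series (fun k : nat => h (p.+1%:Z + k%:Z) + h (p.+1%:Z - k%:Z)) K.+1)
     - (fun K => primed_series (fun k : nat => h (p%:Z + k%:Z) + h (p%:Z - k%:Z)) K.+1)
     = (fun K : nat => h (p%:Z + K%:Z + 1) - h (p%:Z - K%:Z)).
  apply/funext => K; rewrite !fctE; elim: K => [|K IHK].
    rewrite !primed_seriesS !big_geq // !addr0.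
    have -> : p.+1%:Z = p%:Z + 1 by lia.
    by lra.
  have S v : primed_series v K.+2 = primed_series v K.+1 + v K.+1 by exact: seriesSr.
  rewrite !S.
  have -> : p.+1%:Z + K.+1%:Z = p%:Z + K.+1%:Z + 1 by lia.
  have -> : p.+1%:Z - K.+1%:Z = p%:Z - K%:Z by lia.
  have E : p%:Z + K.+1%:Z = p%:Z + K%:Z + 1 by lia.
  by move: IHK; rewrite !E; set a := primed_series _ _; set b := primed_series _ _; lra.
rewrite -[0 in X in _ --> X](subr0 0); apply: cvgB; apply: h0.
  by apply/cvgnyPge => A; exists A => //= K /= AK; lia.
by apply/cvgnyPge => A; exists (A + p)%N => //= K /= AK; lia.
Unshelve. all: by end_near. Qed.

(** As [a] is even, the primed series is a symmetric sum over the integers k of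
    [a k * cosMean n (k - i)]. Centred at i, the weights select the offsets 2rn; r = 0 gives the
    subtracted [a i]. *)
Lemma aliasing_series (a : int -> R) n (i : nat) (l : R) : (0 < n)%N ->
  (forall k, a (- k) = a k) -> (fun k : nat => a k%:Z) @ \oo --> 0 ->
  primed_series (fun k => a k%:Z *
    (cosMean R n (k%:Z - i%:Z) + cosMean R n (k%:Z + i%:Z))) @ \oo --> l ->
  (fun N => \sum_(1 <= r < N) (-1) ^+ r *
    (a ((2 * r * n)%N%:Z - i%:Z) + a ((2 * r * n)%N%:Z + i%:Z))) @ \oo
    --> l - a i%:Z.
Proof.
move=> n0 aN a0; pose h k := a k * cosMean R n (k - i%:Z).
have -> : (fun k : nat => a k%:Z *
    (cosMean R n (k%:Z - i%:Z) + cosMean R n (k%:Z + i%:Z)))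
    = (fun k : nat => h k%:Z + h (- k%:Z)).
  apply/funext => k; rewrite /h aN -opprD cosMeanN; ring.
move=> hl; rewrite -cvg_shiftS.
(* Recentring at i is needed when n <= i: the window |k| < K then contains
   different numbers of indices i + 2rn with r > 0 and with r < 0. *)
have {}hl : primed_series (fun k : nat => h (i%:Z + k%:Z) + h (i%:Z - k%:Z)) @ \oo --> l.
  apply: (@primed_series_shift h (fun k => `|a k%:Z|)) hl; last exact/norm_cvg0P.
  move=> k; have -> : a `|k|%N%:Z = a k by case: k => // k; rewrite NegzE abszN aN.
  by rewrite normrM ler_piMr // cosMean_norm.
(* [F] pairs the offsets k and -k from i; at 0 it already includes the halving. *)
pose F (k : nat) := if k == 0%N then a i%:Z else a (k%:Z - i%:Z) + a (k%:Z + i%:Z).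
have hF N : primed_series (fun k : nat => h (i%:Z + k%:Z) + h (i%:Z - k%:Z)) N
    = \sum_(0 <= k < N) F k * cosMean R n k%:Z.
  apply: eq_bigr => k _; rewrite /F /h; have [->|k0] := eqVneq k 0%N.
    rewrite !addr0 subrr /=.
    by lra.
  have -> : i%:Z + k%:Z - i%:Z = k%:Z by ring.
  have -> : i%:Z - k%:Z - i%:Z = - k%:Z by ring.
  rewrite cosMeanN -[a (i%:Z - _)]aN opprB [i%:Z + _]addrC /=.
  by ring.
(* Along these lengths the sums consist of whole blocks, as in [sum_cosMean], and always contain the
   term r = 0 to be split off. *)
have sub : (fun N => 2 * N.+1 * n)%N @ \oo --> \oo.
  by apply/cvgnyPge => A; exists A => //= N /= AN; nia.
set W := primed_series _ in hl hF *.
rewrite [X in X @ _](_ : _ = (W \o (fun N => 2 * N.+1 * n)%N) - cst (a i%:Z)).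
  by apply: cvgB; [exact: cvg_comp sub hl|exact: cvg_cst].
apply/funext => N; rewrite !fctE /= hF sum_cosMean // [in RHS]big_ltn // expr0 mul1r muln0 mul0n.
rewrite [in RHS]addrC addKr; apply: eq_big_nat => r /andP[r0 _].
by rewrite /F ifF //; nia.
Qed.

(** The quadrature is a finite sum, so it commutes with the limit defining [F] at the nodes;
    [cosMean_mul] then gives the weights of [aliasing_series]. *)
Lemma gauss_chebyshev_aliasing (a : int -> R) (F : R -> R) n (x : 'I_n -> R) (i : nat) :
  (0 < n)%N -> chebRoots x -> (forall k, a (- k) = a k) ->
  (forall s, -1 <= s <= 1 ->
    primed_series (fun k => a k%:Z * chebT k s) @ \oo --> F s) ->
  (fun N => \sum_(1 <= r < N) (-1) ^+ r *
    (a ((2 * r * n)%N%:Z - i%:Z) + a ((2 * r * n)%N%:Z + i%:Z))) @ \oo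
    --> 2 / n%:R * \sum_(l < n) F (x l) * chebT i (x l) - a i%:Z.
Proof.
move=> n0 xr aN aF; apply: aliasing_series => //.
  (* T_k(1) = 1, so convergence at s = 1 forces a_k to tend to 0. *)
  have s1 : -1 <= 1 :> R by lra.
  have := primed_series_decay (aF 1 _); rewrite s1 lexx => /(_ isT).
  by under eq_fun do rewrite /chebT acos1 mulr0 cos0 mulr1.
rewrite (sum_chebRoots (fun s => F s * chebT i s) xr).
have quad (k : nat) : a k%:Z * (cosMean R n (k%:Z - i%:Z) + cosMean R n (k%:Z + i%:Z))
    = 2 / n%:R * \sum_(l < n) a k%:Z * chebT k (cos (gaussAngle R n l)) *
        chebT i (cos (gaussAngle R n l)).
  rewrite -cosMean_mul mulrCA mulr_sumr; congr (_ * _); apply: eq_bigr => l _.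
  by rewrite !chebT_cos ?gaussAngle_itv // mulrA.
rewrite [X in X @ _](_ : _ = (fun K => 2 / n%:R * \sum_(l < n)
    primed_series (fun k => a k%:Z * chebT k (cos (gaussAngle R n l))) K *
    chebT i (cos (gaussAngle R n l)))).
  apply: cvgMl_tmp; apply: cvg_big => [|l _]; first exact: add_continuous.
  by apply: cvgMr_tmp; apply: aF; rewrite cos_geN1 cos_le1.
apply/funext => K; under [in RHS]eq_bigr do rewrite mulr_suml.
rewrite [in RHS]exchange_big mulr_sumr /=; apply: eq_bigr => k _.
have [_|k0] := eqVneq k 0%N; last exact: quad.
rewrite (quad 0%N) -[LHS]mulrA mulr_suml; congr (_ * _).
by apply: eq_bigr => l _; rewrite mulrAC.
Qed.

(** * Parity of the coefficients, and iterated limits *)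

Lemma chebCoefNl (f : R -> R -> R) i j : chebCoef f (- i) j = chebCoef f i j.
Proof.
rewrite /chebCoef; congr (_ * Rintegral _ _ _); apply/funext => ty.
congr (Rintegral _ _ _); apply/funext => tx.
by rewrite mulrNz mulNr cosN.
Qed.

Lemma chebCoefNr (f : R -> R -> R) i j : chebCoef f i (- j) = chebCoef f i j.
Proof.
rewrite /chebCoef; congr (_ * Rintegral _ _ _); apply/funext => ty.
congr (Rintegral _ _ _); apply/funext => tx.
by rewrite mulrNz mulNr cosN.
Qed.

(** For K and L large, [u (K, L)] is within e of l; this closed bound survives the limit in L and so
    holds for [phi K]. *)
Lemma cvg_iterated (u : nat * nat -> R) (phi : nat -> R) (l : R) :
  u @ (\oo, \oo) --> l ->
  (forall K, (fun L => u (K, L)) @ \oo --> phi K) -> phi @ \oo --> l.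
Proof.
move=> ul uphi; apply/cvgrPdist_le => e e0.
have /cvgrPdist_le/(_ e e0) [[P Q] /= [Poo Qoo] PQ] := ul.
near=> K; have lphi : (fun L => `|l - u (K, L)|) @ \oo --> `|l - phi K|.
  by apply: cvg_norm; apply: cvgB (uphi K); exact: cvg_cst.
rewrite -(cvg_lim (@Rhausdorff R) lphi); apply: limr_le; first exact: cvgP lphi.
near=> L.
by apply: (PQ (K, L)); split => /=; [near: K|near: L].
Unshelve. all: by end_near. Qed.

Lemma cvg_iteratedC (u : nat * nat -> R) (phi : nat -> R) (l : R) :
  u @ (\oo, \oo) --> l ->
  (forall L, (fun K => u (K, L)) @ \oo --> phi L) -> phi @ \oo --> l.
Proof.
move=> ul; apply: (@cvg_iterated (fun p => u (p.2, p.1))).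
by apply: cvg_comp ul; apply: cvg_pair; [exact: cvg_snd|exact: cvg_fst].
Qed.

(** Both iterated sums equal the limit of the rectangular partial sums; the convergent rows and
    columns supply the inner limits. *)
Lemma cvg_double_series1_exchange (u : nat -> nat -> R) : cvg_double_series1 u ->
  exists2 l : R, (fun K => \sum_(1 <= k < K) \sum_(1 <= l <oo) u k l) @ \oo --> l &
    (fun L => \sum_(1 <= l < L) \sum_(1 <= k <oo) u k l) @ \oo --> l.
Proof.
move=> [/cvg_ex[l ul] urow ucol]; exists l.
  apply: cvg_iterated ul _ => K /=.
  (* The range condition is kept because only rows of positive index are assumed to converge. *)
  rewrite big_nat_cond; under eq_fun do rewrite big_nat_cond.
  apply: cvg_big => [|k /andP[/andP[k0 _] _]]; first exact: add_continuous.
  exact: urow.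
apply: cvg_iteratedC ul _ => L /=.
under eq_fun do rewrite exchange_big big_nat_cond.
rewrite big_nat_cond.
apply: cvg_big => [|k /andP[/andP[k0 _] _]]; first exact: add_continuous.
exact: ucol.
Qed.

End Series.

(** * Quadrature in x, then in y *)

Theorem mainTheorem4 (R : realType) (f : R -> R -> R) (g : nat -> R -> R)
  (nx ny : nat) (x : 'I_nx -> R) (y : 'I_ny -> R) (i j : nat)
  (nx_gt0 : (0 < nx)%N) (ny_gt0 : (0 < ny)%N)
  (g_repr : forall (m : nat) (s : R), -1 <= s <= 1 ->
     primed_series (fun k => chebCoef f k%:Z m%:Z * chebT k s) @ \oo --> g m s)
  (f_repr : forall s t : R, -1 <= s <= 1 -> -1 <= t <= 1 ->
     primed_series (fun m => g m s * chebT m t) @ \oo --> f s t)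
  (x_roots : chebRoots x) (y_roots : chebRoots y) :
  let c := chebCoef f in
  let A (kx : nat) : R := (-1) ^+ kx *
    (c ((2 * kx * nx)%N%:Z - i%:Z) j%:Z + c ((2 * kx * nx)%N%:Z + i%:Z) j%:Z) in
  let B (ky : nat) : R := (-1) ^+ ky *
    (c i%:Z ((2 * ky * ny)%N%:Z - j%:Z) + c i%:Z ((2 * ky * ny)%N%:Z + j%:Z)) in
  let D (kx ky : nat) : R := (-1) ^+ (kx + ky) *
    (c ((2 * kx * nx)%N%:Z - i%:Z) ((2 * ky * ny)%N%:Z - j%:Z) +
     c ((2 * kx * nx)%N%:Z - i%:Z) ((2 * ky * ny)%N%:Z + j%:Z) +
     c ((2 * kx * nx)%N%:Z + i%:Z) ((2 * ky * ny)%N%:Z - j%:Z) +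
     c ((2 * kx * nx)%N%:Z + i%:Z) ((2 * ky * ny)%N%:Z + j%:Z)) in
  (* the formula with the terms summed in the order of the representation
     (x-index inside, y-index outside); every series involved converges *)
  [/\ cvg_series1 A,
      forall ky, (0 < ky)%N -> cvg_series1 (D^~ ky),
      cvg_series1 (fun ky => B ky + \sum_(1 <= kx <oo) D kx ky) &
      quadCoef f x y i j =
        c i%:Z j%:Z + \sum_(1 <= kx <oo) A kx +
        \sum_(1 <= ky <oo) (B ky + \sum_(1 <= kx <oo) D kx ky)] /\
  (* the formula with its sums separated and in the displayed order, as soon as
     the series in it converge *)
  (cvg_series1 B -> cvg_double_series1 D ->
   quadCoef f x y i j =
     c i%:Z j%:Z + \sum_(1 <= kx <oo) A kx + \sum_(1 <= ky <oo) B ky +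
     \sum_(1 <= kx <oo) \sum_(1 <= ky <oo) D kx ky).
Proof.
move=> c A B D.
have cNl k m : c (- k) m = c k m by exact: chebCoefNl.
have cNr k m : c k (- m) = c k m by exact: chebCoefNr.
(* The absolute value extends the x-quadrature of g_m evenly to the indices 2k ny - j, which may be
   negative. *)
pose G (m : int) : R := 2 / nx%:R * \sum_(l < nx) g `|m|%N (x l) * chebT i (x l).
have GN m : G (- m) = G m by rewrite /G abszN.
pose Am (m : int) (kx : nat) : R := (-1) ^+ kx *
  (c ((2 * kx * nx)%N%:Z - i%:Z) m + c ((2 * kx * nx)%N%:Z + i%:Z) m).
(* Aliasing in x at a fixed y-index m: m = j gives [A], while m = 2k ny - j and m = 2k ny + j will
   give [D]. *)
have AmG m : (fun N => \sum_(1 <= k < N) Am m k) @ \oo --> G m - c i%:Z m.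
  have -> : Am m = Am `|m|%N%:Z.
    by case: m => // m; apply/funext => k; rewrite /Am NegzE !cNr abszN.
  have -> : c i%:Z m = c i%:Z `|m|%N%:Z by case: m => // m; rewrite NegzE cNr abszN.
  apply: (gauss_chebyshev_aliasing (a := c^~ `|m|%N%:Z) (F := g `|m|%N)) => //.
  exact: g_repr.
pose Fx t : R := 2 / nx%:R * \sum_(l < nx) f (x l) t * chebT i (x l).
have xD l : -1 <= x l <= 1.
  by have : range x (x l) by [exists l]; rewrite x_roots.2 => -[].
(* The x-quadrature of the y-expansions of f at the nodes expands [Fx] with coefficients [G]. *)
have GF t : -1 <= t <= 1 ->
    primed_series (fun m => G m%:Z * chebT m t) @ \oo --> Fx t.
  move=> tD; rewrite [X in X @ _](_ : _ = (fun K => 2 / nx%:R * \sum_(l < nx)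
      primed_series (fun m => g m (x l) * chebT m t) K * chebT i (x l))).
    apply: cvgMl_tmp; apply: cvg_big => [|l _]; first exact: add_continuous.
    by apply: cvgMr_tmp; exact: f_repr.
  apply/funext => K; under [in RHS]eq_bigr do rewrite mulr_suml.
  rewrite [in RHS]exchange_big mulr_sumr /=; apply: eq_bigr => k _.
  rewrite /G absz_nat; case: ifP => _; last first.
    rewrite -[LHS]mulrA mulr_suml; congr (_ * _).
    by apply: eq_bigr => l _; rewrite mulrAC.
  rewrite -[LHS]mulrA -[LHS]mulrA mulr_suml; congr (_ * _).
  by apply: eq_bigr => l _ /=; ring.
have quadE : quadCoef f x y i j = 2 / ny%:R * \sum_(l < ny) Fx (y l) * chebT j (y l).
  rewrite /quadCoef exchange_big /= [in RHS](eq_bigr (fun l => 2 / nx%:R *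
    \sum_(l' < nx) f (x l') (y l) * chebT i (x l') * chebT j (y l))); last first.
    by move=> l _; rewrite /Fx -[LHS]mulrA mulr_suml.
  by rewrite -mulr_sumr mulrA; congr (_ * _); rewrite invfM; ring.
(* Aliasing in y, applied to [Fx]. *)
have GB : (fun N => \sum_(1 <= k < N) (-1) ^+ k *
    (G ((2 * k * ny)%N%:Z - j%:Z) + G ((2 * k * ny)%N%:Z + j%:Z))) @ \oo
    --> quadCoef f x y i j - G j%:Z.
  by rewrite quadE; exact: gauss_chebyshev_aliasing.
(* By [AmG], each [G m] splits into c_{i,m}, collected in [B ky], and a series in kx, collected in
   [D]. *)
have Dcol ky : (fun N => \sum_(1 <= k < N) D k ky) @ \oo --> (-1) ^+ ky *
    (G ((2 * ky * ny)%N%:Z - j%:Z) + G ((2 * ky * ny)%N%:Z + j%:Z)) - B ky.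
  set m1 := _ - j%:Z; set m2 := _ + j%:Z.
  have -> : (-1) ^+ ky * (G m1 + G m2) - B ky =
      (-1) ^+ ky * ((G m1 - c i%:Z m1) + (G m2 - c i%:Z m2)) by rewrite /B; ring.
  rewrite [X in X @ _](_ : _ = (fun N => (-1) ^+ ky *
    (\sum_(1 <= k < N) Am m1 k + \sum_(1 <= k < N) Am m2 k))).
    by apply: cvgMl_tmp; apply: cvgD; exact: AmG.
  apply/funext => N; rewrite -big_split mulr_sumr; apply: eq_bigr => k _ /=.
  by rewrite /D /Am exprD -/m1 -/m2; ring.
have Dlim ky := cvg_lim (@Rhausdorff R) (Dcol ky).
have BD : (fun N => \sum_(1 <= ky < N) (B ky + \sum_(1 <= kx <oo) D kx ky)) @ \oo
    --> quadCoef f x y i j - G j%:Z.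
  by under eq_fun do under eq_bigr do rewrite Dlim addrC subrK.
have main : quadCoef f x y i j =
    c i%:Z j%:Z + \sum_(1 <= kx <oo) A kx +
    \sum_(1 <= ky <oo) (B ky + \sum_(1 <= kx <oo) D kx ky).
  rewrite (cvg_lim (@Rhausdorff R) BD) (cvg_lim (@Rhausdorff R) (AmG j%:Z)).
  by ring.
split.
  split => //; first exact: cvgP (AmG j%:Z).
    by move=> ky _; exact: cvgP (Dcol ky).
  exact: cvgP BD.
move=> Bcvg Dcvg; rewrite main -[RHS]addrA; congr (_ + _).
(* Regular convergence exchanges the order of summation in [main] for the displayed one; convergence
   of the [B] series then allows the outer series to be split. *)
have [l rows cols] := cvg_double_series1_exchange Dcvg.
rewrite (cvg_lim (@Rhausdorff R) rows); apply: cvg_lim; first exact: Rhausdorff.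
under eq_fun do rewrite big_split.
exact: cvgD Bcvg cols.
Qed.
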